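(* Let $V$ be a finite-dimensional vector space over a field $K$, and let $\{W_i\}_{i \in I}$ be a linear covering of $V$. Then $\# I \geq \# K + 1$.
   Context: $\# S$ denotes the cardinality of a set $S$; the inequality is between (possibly infinite) cardinal numbers. A linear covering of a $K$-vector space $V$ is a collection $\{W_i\}_{i \in I}$ of proper $K$-linear subspaces of $V$ such that $V = \bigcup_{i \in I} W_i$. *)

(* Defs.v *)
From HB Require Import structures.
From mathcomp Require Import all_boot all_algebra.
From mathcomp Require Import boolp classical_sets functions cardinality.

Set Implicit Arguments.
Unset Strict Implicit.
Unset Printing Implicit Defensive.

Local Open Scope classical_set_scope.

Definition linear_covering (K : fieldType) (V : vectType K) (I : Type)
    (W : I -> {vspace V}) : Prop :=
  (forall i, W i <> fullv) /\ \bigcup_(i in [set: I]) [set` W i] = [set: V].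

(* Main.v *)
(* Let U be a subspace of minimal dimension among those contained in no W i.
   Its dimension is at least 2, because each line lies in the W i that covers
   a generator; so write U = <u> + <w> + T as a direct sum.  The hyperplanes
   <u + a w> + T (for a in K) and <w> + T of U each lie in some W i by
   minimality, and two distinct ones cannot lie in the same W i because they
   span U. *)

Require Import Defs.
From HB Require Import structures.
From mathcomp Require Import all_boot all_algebra.
From mathcomp Require Import boolp classical_sets functions cardinality.

Set Implicit Arguments.
Unset Strict Implicit.
Unset Printing Implicit Defensive.

Local Open Scope classical_set_scope.
Local Open Scope card_scope.

Import GRing.Theory.

Section Pencil.

Variables (K : fieldType) (V : vectType K).
Implicit Types (U T : {vspace V}) (u w v : V).

Lemma vline_split U v : v != 0%R -> v \in U ->
  exists2 T, U = (<[v]> + T)%VS & \dim U = (\dim T).+1.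
Proof.
move=> v_neq0 vU; have capE : (U :&: <[v]>)%VS = <[v]>%VS by apply/capv_idPr.
exists (U :\: <[v]>)%VS; first by rewrite -{1}(addv_diff_cap U <[v]>) capE addvC.
by rewrite -(dimv_cap_compl U <[v]>) capE dim_vline v_neq0.
Qed.

(** [K + unit] plays the projective line over [K], with [inr tt] as the point at infinity. *)
Definition pencil_vec u w (s : K + unit) : V :=
  if s is inl a then (u + a *: w)%R else w.

(** If one of the two vectors is [w], subtracting a multiple of it from the other leaves [u].
    Otherwise their difference is [(a - b) *: w] with [a - b] invertible, which gives [w] first. *)
Lemma pencil_vec_span u w (s t : K + unit) U : s <> t ->
  pencil_vec u w s \in U -> pencil_vec u w t \in U -> (<[u]> + <[w]> <= U)%VS.
Proof.
move=> neq_st sU tU.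
suff [a wU uU] : exists2 a, w \in U & (u + a *: w)%R \in U.
  by rewrite subv_add -!memvE wU -(rpredDr _ (memvZ a wU)) uU.
case: s t sU tU neq_st => [a|[]] [b|[]] //= sU tU neq_st;
  [exists a | by exists a | by exists b] => //.
have ab_neq0 : (a - b)%R != 0%R.
  by rewrite subr_eq0; apply/eqP => eq_ab; apply: neq_st; rewrite eq_ab.
have := memvB sU tU; rewrite opprD addrACA subrr add0r -scalerBl.
by move=> /(memvZ (a - b)^-1); rewrite scalerK.
Qed.

(** Properness makes [fullv] a candidate, so a least dimension exists by well-ordering of the
    naturals, even for infinite [I]. *)
Lemma minimal_uncovered (I : Type) (W : I -> {vspace V}) :
  (forall i, W i <> fullv) ->
  exists2 U, (forall i, ~~ (U <= W i)%VS) &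
    forall T, \dim T < \dim U -> exists i, (T <= W i)%VS.
Proof.
move=> W_proper.
pose P n := `[< exists2 U, (forall i, ~~ (U <= W i)%VS) & \dim U = n >].
have exP : exists n, P n.
  exists (\dim {:V}); apply/asboolP; exists fullv => // i.
  apply/negP => fullW; apply: (W_proper i); apply/eqP.
  by rewrite eqEsubv subvf.
case: (ex_minnP exP) => n /asboolP[U U_unc <-] U_min; exists U => // T ltTU.
apply: contrapT => T_unc; move: ltTU; rewrite ltnNge => /negP; apply.
by apply: U_min; apply/asboolP; exists T => // i; apply/negP => TW;
  apply: T_unc; exists i.
Qed.

End Pencil.

(* The cardinal sum #K + 1 is the cardinality of the disjoint union K + unit. *)
Theorem theorem4 (K : fieldType) (V : vectType K) (I : Type)
    (W : I -> {vspace V}) (hW : linear_covering W) :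
  [set: K + unit] #<= [set: I].
Proof.
case: hW => W_proper W_cover.
have line_cov v : exists i, (<[v]> <= W i)%VS.
  have : [set: V] v by [].
  by rewrite -W_cover => -[i _ vW]; exists i; rewrite -memvE.
have [U U_unc U_min] := minimal_uncovered W_proper.
have U_not_line v : U != <[v]>%VS.
  apply/eqP => Uv; have [i vW] := line_cov v.
  by have := U_unc i; rewrite Uv vW.
have u_neq0 : vpick U != 0%R.
  (* Covering the zero vector yields an index [i], so [I] is nonempty; [W i] would contain [U] if
     [U] were zero. *)
  have [i _] := line_cov 0%R; rewrite vpick0.
  by apply: contra (U_unc i) => /eqP->; exact: sub0v.
have [D U_def dimU] := vline_split u_neq0 (memv_pick U).
have w_neq0 : vpick D != 0%R.
  rewrite vpick0; apply: contra (U_not_line (vpick U)) => /eqP D0.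
  by rewrite {1}U_def D0 addv0.
have [T D_def dimD] := vline_split w_neq0 (memv_pick D).
move: (vpick U) (vpick D) => u w in U_def D_def *.
have hyperplane_cov s : exists i, (<[pencil_vec u w s]> + T <= W i)%VS.
  (* The sum has dimension at most [1 + \dim T], while [\dim U] is [\dim T + 2]. *)
  apply: U_min; rewrite dimU dimD ltnS.
  apply: leq_trans (dimv_add_leqif _ _) _.
  by rewrite dim_vline -add1n leq_add2r leq_b1.
have [f fP] := choice hyperplane_cov.
(* The preimage of [[set: I]] under [f] is all of [K + unit], so injectivity of [f] suffices. *)
apply: (@card_ge_preimage _ _ [set: I] f) => s t _ _ eq_f.
apply: contrapT => neq_st.
have := fP t; rewrite -eq_f subv_add -memvE => /andP[tW _].
have := fP s; rewrite subv_add -memvE => /andP[sW TW].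
have := U_unc (f s); rewrite U_def D_def addvA subv_add TW andbT.
by rewrite (pencil_vec_span neq_st sW tW).
Qed.
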